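(* Let $n=2m+1>1$. Then the maximum of $\mathrm{s}^*_{\mathcal B}$ over all permutations in $S_n$ is $\left(m^m(m+1)(m+2)^{m-1}\right)^{1/(n-1)}$, and it is attained precisely by the following four permutations: the permutation $\pi$ defined by $\pi(1)=m+1$ and $\pi(i+1)=\rho(\pi(i))$ for $1\le i<n$, where $\rho$ is the $n$-cycle on $\{1,\dots,n\}$ specified in the context, together with $i\mapsto n+1-\pi(i)$, $i\mapsto \pi(n+1-i)$ and $i\mapsto n+1-\pi(n+1-i)$.
   Context: $S_n$ is the set of all permutations of $\{1,\dots,n\}$. For $n\ge2$ and $\pi\in S_n$, $$\mathrm{s}^*_{\mathcal B}(\pi)=\left(\prod_{i=1}^{n-1}|\pi(i)-\pi(i+1)|\right)^{1/(n-1)}$$ (the multiplicative stretch of $\pi$ with respect to $\mathcal B=\{\{i,i+1\}:1\le i<n\}$). The $n$-cycle $\rho\in S_n$, $n=2m+1$, is defined as follows. When $m$ is odd: $\rho(m)=m+1$; $\rho(m+2)=1$; $\rho(i)=i+m$ for $i$ even, $i<m+2$; $\rho(i)=i+(m+2)$ for $i$ odd, $i<m$; $\rho(i)=i-m$ for $i$ even, $i>m+1$; $\rho(i)=i-(m+2)$ for $i$ odd, $i>m+2$. When $m$ is even: $\rho(m)=m+1$; $\rho(1)=m+2$; $\rho(i)=i+m$ for $i$ odd, $1<i<m+2$; $\rho(i)=i+(m+2)$ for $i$ even, $i<m$; $\rho(i)=i-m$ for $i$ even, $i>m+1$; $\rho(i)=i-(m+2)$ for $i$ odd, $i>m+2$.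 *)

(* Defs.v *)
From mathcomp Require Import all_boot all_order all_algebra all_fingroup.
From mathcomp Require Import all_classical all_reals all_analysis.
From mathcomp Require Import zify.

Set Implicit Arguments.
Unset Strict Implicit.
Unset Printing Implicit Defensive.

Import Order.TTheory GRing.Theory Num.Theory.
Local Open Scope ring_scope.

(** Throughout, [k : 'I_n] stands for the element [k.+1] of {1, ..., n}. *)

(** The multiplicative stretch of [s] with respect to the pairs {i, i+1}.
    It is meant for [1 < n]. *)
Definition mstretch (R : realType) (n : nat) (s : 'S_n) : R :=
  (\prod_(i < n) \prod_(j < n | val j == (val i).+1)
     `|(s i)%:R - (s j)%:R|) `^ (n.-1)%:R^-1.

(** The n-cycle rho as a function of [i] in {1, ..., n}, where n = 2m + 1.
    For [0 < m] each of the two lists of conditions covers {1, ..., n} without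
    overlap, so neither the order of the tests nor the default matters. *)
Definition rho_nat (m i : nat) : nat :=
  (if odd m then
     if i == m then m + 1
     else if i == m + 2 then 1
     else if ~~ odd i && (i < m + 2) then i + m
     else if odd i && (i < m) then i + (m + 2)
     else if ~~ odd i && (m + 1 < i) then i - m
     else if odd i && (m + 2 < i) then i - (m + 2)
     else i
   else
     if i == m then m + 1
     else if i == 1 then m + 2
     else if odd i && (1 < i < m + 2) then i + m
     else if ~~ odd i && (i < m) then i + (m + 2)
     else if ~~ odd i && (m + 1 < i) then i - m
     else if odd i && (m + 2 < i) then i - (m + 2)
     else i)%N.

(** The default [i] of [insubd] is never used when [0 < m]; see [rho_funE]. *)
Definition rho_fun (m : nat) (i : 'I_(2 * m + 1)) : 'I_(2 * m + 1) :=
  insubd i (rho_nat m i.+1).-1.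

Lemma rho_nat_bounds (m i : nat) : (0 < m -> 0 < i <= 2 * m + 1 ->
  0 < rho_nat m i <= 2 * m + 1)%N.
Proof. by rewrite /rho_nat; repeat case: ifP => ?; lia. Qed.

Lemma rho_funE (m : nat) (i : 'I_(2 * m + 1)) :
  (0 < m)%N -> (rho_fun i).+1 = rho_nat m i.+1.
Proof.
move=> m_gt0; have := @rho_nat_bounds m i.+1 m_gt0.
have := ltn_ord i; rewrite /rho_fun val_insubd => ? /(_ _); case: ifP; lia.
Qed.

Lemma rho_nat_inj (m i j : nat) : (0 < m -> 0 < i <= 2 * m + 1 ->
  0 < j <= 2 * m + 1 -> rho_nat m i = rho_nat m j -> i = j)%N.
Proof. by rewrite /rho_nat; case: ifP => ?; repeat case: ifP => ?; lia. Qed.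

Lemma rho_fun_inj (m : nat) : injective (@rho_fun m).
Proof.
have [->|m_gt0] := posnP m; first by move=> i j _; apply: val_inj; case: i j => [[]//] ? [[]].
move=> i j eq_ij; apply: val_inj; apply: succn_inj.
have ? := ltn_ord i; have ? := ltn_ord j.
apply: (@rho_nat_inj m) => //=; try lia.
by rewrite -!rho_funE // eq_ij.
Qed.

Definition rho (m : nat) : 'S_(2 * m + 1) := perm (@rho_fun_inj m).

Lemma mid_subproof (m : nat) : (m < 2 * m + 1)%N.
Proof. lia. Qed.

Definition mid (m : nat) : 'I_(2 * m + 1) := Ordinal (mid_subproof m).

(** [pi_fun] is determined by pi(1) = m + 1 and pi(i + 1) = rho(pi(i)). *)
Definition pi_fun (m : nat) (i : 'I_(2 * m + 1)) : 'I_(2 * m + 1) :=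
  iter i (rho m) (mid m).

Lemma iter_rhoE (m k : nat) : (0 < m -> k < 2 * m + 1 ->
  (iter k (rho m) (mid m)).+1 =
    if k <= m then if odd k then 2 * m + 2 - k else m + 1 - k
    else if odd k then k + 1 else k - m)%N.
Proof.
move=> m_gt0; elim: k => [|k IHk] lt_k; first by rewrite /=; lia.
have IH := IHk (ltnW lt_k); rewrite iterS permE rho_funE // IH.
by case: (leqP k m) => ?; case: (boolP (odd k)) => ? /=; rewrite /rho_nat;
  repeat case: ifP => ?; lia.
Qed.

Lemma pi_fun_inj (m : nat) : injective (@pi_fun m).
Proof.
have [->|m_gt0] := posnP m; first by move=> i j _; apply: val_inj; case: i j => [[]//] ? [[]].
move=> i j /(congr1 (fun k : 'I__ => k.+1)).
have ? := ltn_ord i; have ? := ltn_ord j.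
rewrite /pi_fun !iter_rhoE // => eq_ij; apply: val_inj => /=; move: eq_ij.
by repeat case: ifP => ?; lia.
Qed.

Definition pi_perm (m : nat) : 'S_(2 * m + 1) := perm (@pi_fun_inj m).

Lemma rho_cycle (m : nat) : porbit (rho m) (mid m) = [set: 'I_(2 * m + 1)].
Proof.
apply/setP => x; rewrite inE; apply/porbitP.
exists (invF (@pi_fun_inj m) x).
by rewrite permX -[LHS](f_invF (@pi_fun_inj m)).
Qed.

(** The permutation k |-> n + 1 - k. *)
Definition rev_perm (n : nat) : 'S_n := perm (@rev_ord_inj n).

(* Main.v *)
Require Import Defs.
From mathcomp Require Import all_boot all_order all_algebra all_fingroup.
From mathcomp Require Import all_classical all_reals all_analysis.
From mathcomp Require Import zify ring lra.

Import Order.TTheory GRing.Theory Num.Theory.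
Local Open Scope ring_scope.

(** Centre the values at 0, so that a permutation becomes a sequence x_0, ...,
    x_2m enumerating {-m, ..., m} with edges e_k = |x_k - x_(k+1)|, and compare
    each edge with c = m + 1. By Bernoulli's inequality
      e <= c (1 + 1/c)^a (1 - 1/c)^b,
    where e = c + a - b and a = 0 or b = 0, strictly if a + b > 1. Let A and B
    be the sums of the a's and of the b's over all edges. From e_k <= |x_k| +
    |x_(k+1)| one gets B >= A + |x_0| + |x_2m| >= A + 1. If B >= A + 2, the
    product of the right-hand sides is already below the claimed maximum.
    Otherwise B = A + 1, one end of the sequence is 0, the other one is 1 or -1,
    and the signs alternate. Up to symmetry x_0 = 0 < x_1; identifying
    i > 0 with i - (m + 1) then turns the sequence into a walk on
    {1, ..., m + 1} whose step lengths are the a's and b's. It starts at m + 1,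
    reaches 1 and ends at m, so A + B >= 2m - 1, which gives the bound. For
    equality all steps have length at most 1; as 1 is visited twice, this
    determines the walk. *)

(** * Centred values, edges and their symmetries *)

(** Positions are natural numbers, so that [k.+1] and sums over ranges need no ordinals; only
    [k <= 2 * m] is meaningful, any other [k] defaults to the middle position. *)
Definition centered {m : nat} (s : 'S_(2 * m + 1)) (k : nat) : int :=
  (s (insubd (mid m) k) : nat)%:Z - m%:Z.

Definition edge {m : nat} (s : 'S_(2 * m + 1)) (k : nat) : nat :=
  `|centered s k - centered s k.+1|%N.

Lemma centered_ord {m} (s : 'S_(2 * m + 1)) (i : 'I_(2 * m + 1)) :
  centered s i = (s i : nat)%:Z - m%:Z.
Proof. by rewrite /centered valKd. Qed.

Lemma centered_inj {m} (s : 'S_(2 * m + 1)) j k : (j <= 2 * m)%N -> (k <= 2 * m)%N ->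
  centered s j = centered s k -> j = k.
Proof.
move=> lej lek /addIr[] /val_inj /perm_inj /(congr1 val).
by rewrite /= !insubdK // -topredE /=; lia.
Qed.

Lemma centered_surj {m} (s : 'S_(2 * m + 1)) (z : int) : (`|z| <= m)%N ->
  exists2 k, (k <= 2 * m)%N & centered s k = z.
Proof.
move=> lez; have lt_z : (`|(z + m%:Z)%R| < 2 * m + 1)%N by lia.
exists (s^-1 (Ordinal lt_z))%g.
  by have := ltn_ord (s^-1 (Ordinal lt_z))%g; lia.
by rewrite centered_ord permKV /=; lia.
Qed.

Lemma centered_ext {m} (s t : 'S_(2 * m + 1)) :
  (forall k, (k <= 2 * m)%N -> centered s k = centered t k) -> s = t.
Proof.
move=> eq_st; apply/permP => i; apply: val_inj.
have lei : (i <= 2 * m)%N by have := ltn_ord i; lia.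
by have := eq_st i lei; rewrite !centered_ord => /addIr[].
Qed.

Lemma centered_compl {m} (s : 'S_(2 * m + 1)) k :
  centered (s * rev_perm (2 * m + 1))%g k = - centered s k.
Proof.
rewrite /centered permM [rev_perm _ _]permE /=.
by have := ltn_ord (s (insubd (mid m) k)); lia.
Qed.

Lemma centered_rev {m} (s : 'S_(2 * m + 1)) k : (k <= 2 * m)%N ->
  centered (rev_perm (2 * m + 1) * s)%g k = centered s (2 * m - k).
Proof.
move=> lek; rewrite /centered permM [rev_perm _ _]permE /=.
congr (_%:Z - _); congr (val (s _)); apply: val_inj.
by rewrite /= !insubdK -?topredE /=; lia.
Qed.

Lemma edge_compl {m} (s : 'S_(2 * m + 1)) k :
  edge (s * rev_perm (2 * m + 1))%g k = edge s k.
Proof. by rewrite /edge !centered_compl; lia. Qed.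

Lemma edge_rev {m} (s : 'S_(2 * m + 1)) k : (k < 2 * m)%N ->
  edge (rev_perm (2 * m + 1) * s)%g k = edge s (2 * m - k.+1).
Proof.
move=> ltk; rewrite /edge !centered_rev ?(ltnW ltk) //.
have -> : (2 * m - k = (2 * m - k.+1).+1)%N by lia.
lia.
Qed.

Lemma edge_gt0 {m} (s : 'S_(2 * m + 1)) k : (k < 2 * m)%N -> (0 < edge s k)%N.
Proof.
move=> ltk; rewrite /edge absz_gt0 subr_eq0; apply/eqP.
by move/(centered_inj s k k.+1 (ltnW ltk) ltk); lia.
Qed.

Lemma sum_centered {m} (s : 'S_(2 * m + 1)) :
  (\sum_(0 <= k < 2 * m + 1) `|centered s k| = m * m + m)%N.
Proof.
rewrite big_mkord.
transitivity (\sum_(i < 2 * m + 1) `|(i : nat)%:Z - m%:Z|)%N.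
  rewrite [RHS](reindex_inj (@perm_inj _ s)).
  by apply: eq_bigr => i _; rewrite centered_ord.
rewrite -(big_mkord xpredT (fun i => `|i%:Z - m%:Z|%N)).
(* Indices [i] and [i + m] with [i < m] contribute [(m - i) + i = m] together; the index [2 * m]
   contributes another [m]. *)
rewrite (@big_cat_nat _ _ _ m) //=; last by lia.
rewrite -{3}[m]add0n big_addn.
have -> : (2 * m + 1 - m = m.+1)%N by lia.
rewrite big_nat_recr //= addnA -big_split /=.
rewrite (eq_big_nat _ _ (F2 := fun=> m)) => [|i /andP[_ lti]]; last by lia.
by rewrite sum_nat_const_nat subn0; lia.
Qed.

(** Inner positions belong to two edges and the ends to one, so adding the ends once more gives
    twice [sum_centered]. *)
Lemma sum_edge_ends {m} (s : 'S_(2 * m + 1)) :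
  (\sum_(0 <= k < 2 * m) (`|centered s k| + `|centered s k.+1|)
     + (`|centered s 0| + `|centered s (2 * m)|) = 2 * m * m.+1)%N.
Proof.
have := sum_centered s; rewrite addn1 big_split /= => S.
have := S; rewrite big_nat_recr //= => S1.
have := S; rewrite big_nat_recl //= => S2.
lia.
Qed.

Lemma edge_le {m} (s : 'S_(2 * m + 1)) k :
  (edge s k <= `|centered s k| + `|centered s k.+1|)%N.
Proof. rewrite /edge; lia. Qed.

Lemma ends_neq0 {m} (s : 'S_(2 * m + 1)) :
  (0 < m -> 0 < `|centered s 0| + `|centered s (2 * m)|)%N.
Proof.
move=> m_gt0; rewrite lt0n; apply/eqP => eq0.
have := centered_inj s 0 (2 * m); lia.
Qed.

(** * Bernoulli's inequality and the majorant of an edge *)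

Lemma bernoulli_le (F : realFieldType) (x : F) (k : nat) :
  -1 <= x -> 1 + k%:R * x <= (1 + x) ^+ k.
Proof.
move=> x_ge; elim: k => [|k IHk]; first by rewrite mul0r addr0 expr0.
rewrite exprS; apply: (@le_trans _ _ ((1 + x) * (1 + k%:R * x))).
  (* This term is the surplus of the product over [1 + k.+1%:R * x]. *)
  have : 0 <= k%:R * x ^+ 2 by rewrite mulr_ge0 ?sqr_ge0.
  by rewrite -natr1; nra.
by apply: ler_wpM2l => //; lra.
Qed.

Lemma bernoulli_lt (F : realFieldType) (x : F) (k : nat) :
  -1 <= x -> x != 0 -> (1 < k)%N -> 1 + k%:R * x < (1 + x) ^+ k.
Proof.
move=> x_ge x_neq0; case: k => [|[|k _]] //.
rewrite exprS; apply: (@lt_le_trans _ _ ((1 + x) * (1 + k.+1%:R * x))).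
  have : 0 < k.+1%:R * x ^+ 2 by rewrite mulr_gt0 // exprn_even_gt0.
  by rewrite -[in X in X -> _]natr1 -!natr1; nra.
by apply: ler_wpM2l; [lra | apply: bernoulli_le].
Qed.

(* Truncated subtraction: at most one of the two exponents is nonzero. *)
Definition majorant (c e : nat) : rat :=
  c%:R * (1 + c%:R^-1) ^+ (e - c) * (1 - c%:R^-1) ^+ (c - e).

Lemma le_majorant (c e : nat) : (0 < c)%N -> e%:R <= majorant c e.
Proof.
rewrite -(ltr0n rat) /majorant => c_gt0.
have ci_gt0 : 0 < c%:R^-1 :> rat by rewrite invr_gt0.
have ci_le1 : c%:R^-1 <= 1 :> rat by rewrite invf_le1 // ler1n -(ltr0n rat).
have cK : c%:R * c%:R^-1 = 1 :> rat by rewrite mulfV // gt_eqF.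
have [lece|/ltnW leec] := leqP c e.
  have /eqP -> : (c - e == 0)%N by rewrite subn_eq0.
  rewrite expr0 mulr1 -{1}(subnKC lece) natrD.
  have /(ler_wpM2l (ltW c_gt0)) := @bernoulli_le rat c%:R^-1 (e - c) ltac:(lra).
  by rewrite mulrDr mulr1 mulrCA cK mulr1.
have /eqP -> : (e - c == 0)%N by rewrite subn_eq0.
rewrite expr0 mulr1.
have /(ler_wpM2l (ltW c_gt0)) := @bernoulli_le rat (- c%:R^-1) (c - e) ltac:(lra).
by rewrite mulrDr mulr1 mulrN mulrN mulrCA cK mulr1 natrB // opprB addrC subrK.
Qed.

Lemma lt_majorant (c e : nat) :
  (0 < c)%N -> (1 < `|e%:Z - c%:Z|)%N -> e%:R < majorant c e.
Proof.
rewrite -(ltr0n rat) /majorant => c_gt0 far.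
have ci_gt0 : 0 < c%:R^-1 :> rat by rewrite invr_gt0.
have ci_neq0 := lt0r_neq0 ci_gt0.
have ci_le1 : c%:R^-1 <= 1 :> rat by rewrite invf_le1 // ler1n -(ltr0n rat).
have cK : c%:R * c%:R^-1 = 1 :> rat by rewrite mulfV // gt_eqF.
have [lece|/ltnW leec] := leqP c e.
  have /eqP -> : (c - e == 0)%N by rewrite subn_eq0.
  rewrite expr0 mulr1 -{1}(subnKC lece) natrD.
  have gap : (1 < e - c)%N by lia.
  have := @bernoulli_lt rat c%:R^-1 (e - c) ltac:(lra) ci_neq0 gap.
  by rewrite -(ltr_pM2l c_gt0) mulrDr mulr1 mulrCA cK mulr1.
have /eqP -> : (e - c == 0)%N by rewrite subn_eq0.
rewrite expr0 mulr1; rewrite -oppr_eq0 in ci_neq0.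
have gap : (1 < c - e)%N by lia.
have := @bernoulli_lt rat (- c%:R^-1) (c - e) ltac:(lra) ci_neq0 gap.
by rewrite -(ltr_pM2l c_gt0) mulrDr mulr1 mulrN mulrN mulrCA cK mulr1 natrB // opprB addrC
  subrK.
Qed.

Lemma prod_majorant (c n : nat) (e : nat -> nat) :
  \prod_(0 <= k < n) majorant c (e k) = c%:R ^+ n
    * (1 + c%:R^-1) ^+ (\sum_(0 <= k < n) (e k - c))
    * (1 - c%:R^-1) ^+ (\sum_(0 <= k < n) (c - e k)).
Proof.
rewrite !big_split /= prodr_const_nat subn0.
by rewrite !(big_morph _ (exprD _) (expr0 _)).
Qed.

(** * Comparing products of majorants with the maximum *)

Definition max_prod (m : nat) : nat := (m ^ m * (m + 1) * (m + 2) ^ (m - 1))%N.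

(** Since [m = c (1 - 1/c)] and [m + 2 = c (1 + 1/c)], the maximum is a product of majorants with
    [A = m - 1] and [B = m]. *)
Lemma max_prodE (m : nat) (c : rat := m.+1%:R) : (0 < m)%N ->
  (max_prod m)%:R
    = c ^+ (2 * m) * (1 + c^-1) ^+ (m - 1) * (1 - c^-1) ^+ m.
Proof.
move=> m_gt0; have c_neq0 : c != 0 by rewrite pnatr_eq0.
have -> : c ^+ (2 * m) = c * c ^+ (m - 1) * c ^+ m.
  by rewrite -exprS -exprD; congr (_ ^+ _); lia.
have -> : c * c ^+ (m - 1) * c ^+ m * (1 + c^-1) ^+ (m - 1) * (1 - c^-1) ^+ m
    = c * (c * (1 + c^-1)) ^+ (m - 1) * (c * (1 - c^-1)) ^+ m.
  by rewrite !exprMn; ring.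
rewrite mulrDr mulrBr mulr1 mulfV // /c -natr1 addrK natr1.
rewrite /max_prod !natrM !natrX addn1 addn2 -[m.+2%:R]natr1; ring.
Qed.

Section Estimates.
Variable m : nat.
Hypothesis m_gt0 : (0 < m)%N.
Let c : rat := m.+1%:R.
Let c_ge2 : 2 <= c. Proof. by rewrite ler_nat. Qed.
Let r := 1 + c^-1.
Let q := 1 - c^-1.
Let ci_gt0 : 0 < c^-1. Proof. rewrite invr_gt0; move: c_ge2; lra. Qed.
Let ci_lt1 : c^-1 < 1. Proof. rewrite invf_lt1; move: c_ge2; lra. Qed.
Let rq_bd : 0 < r * q < 1.
Proof.
have -> : r * q = 1 - c^-1 * c^-1 by rewrite /r /q; ring.
rewrite subr_gt0 gtrBl mulr_gt0 // andbT.
by rewrite mulr_ilt1 // ltW.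
Qed.
Let q_bd : 0 < q < 1.
Proof. by rewrite subr_gt0 gtrBl ci_gt0 ci_lt1. Qed.

Let split_exp a d : c ^+ (2 * m) * r ^+ a * q ^+ (a + d)
  = c ^+ (2 * m) * ((r * q) ^+ a * q ^+ d).
Proof. by rewrite exprD exprMn !mulrA. Qed.

Let cX_gt0 : 0 < c ^+ (2 * m).
Proof. by rewrite exprn_gt0 // ltr0n. Qed.

(** Up to a constant the left side is [(r * q) ^+ a * q], which decreases in [a] because
    [r * q < 1]; the hypotheses give [a >= m - 1]. *)
Lemma aligned_estimate a b : b = (a + 1)%N -> (2 * m - 1 <= a + b)%N ->
  c ^+ (2 * m) * r ^+ a * q ^+ b <= (max_prod m)%:R.
Proof.
move=> -> lem; rewrite max_prodE // -/c -/r -/q.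
have -> : q ^+ m = q ^+ (m - 1 + 1) by congr (_ ^+ _); lia.
have [/andP[rq0 rq1] /andP[q0 q1]] := (rq_bd, q_bd).
rewrite !split_exp ler_pM2l // ler_wpM2r ?exprn_ge0 ?(ltW q0) //.
by apply: ler_wiXn2l; rewrite ?(ltW rq0) ?(ltW rq1) //; lia.
Qed.

(** Up to the same constant the left side is at most [q ^+ 2] and the right side is
    [(r * q) ^+ (m - 1) * q], so it suffices that [q < (r * q) ^+ (m - 1)]. *)
Lemma unaligned_estimate a b : (a + 2 <= b)%N ->
  c ^+ (2 * m) * r ^+ a * q ^+ b < (max_prod m)%:R.
Proof.
move=> leab; rewrite max_prodE // -/c -/r -/q.
have -> : q ^+ m = q ^+ (m - 1 + 1) by congr (_ ^+ _); lia.
have -> : q ^+ b = q ^+ (a + (b - a)) by congr (_ ^+ _); lia.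
have [/andP[rq0 rq1] /andP[q0 q1]] := (rq_bd, q_bd).
rewrite !split_exp ltr_pM2l //.
apply: (@le_lt_trans _ _ (1 * q ^+ 2)).
  apply: ler_pM; rewrite ?exprn_ge0 ?exprn_ile1 ?(ltW rq0) ?(ltW rq1) ?(ltW q0) //.
  by apply: ler_wiXn2l; rewrite ?(ltW q0) ?(ltW q1) //; lia.
(* Bernoulli: [(r * q) ^ (m - 1) >= 1 - (m - 1) / c ^ 2 > 1 - 1 / c = q] *)
rewrite mul1r expr1 expr2 ltr_pM2r //.
have -> : r * q = 1 - c^-1 ^+ 2 by rewrite /r /q; ring.
apply: lt_le_trans (@bernoulli_le rat (- c^-1 ^+ 2) (m - 1) _); last first.
  by rewrite lerN2 exprn_ile1 // ltW.
rewrite /q ltrD2l mulrN ltrN2 expr2 mulrA -[X in _ < X]mul1r ltr_pM2r //.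
by rewrite ltr_pdivrMr ?mul1r /c ?ltr_nat ?ltr0n //; lia.
Qed.

End Estimates.

(** * Deviations of edges, and normal forms up to symmetry *)

Lemma walk_dist (y : nat -> int) (i j : nat) : (i <= j)%N ->
  (`|y j - y i| <= \sum_(i <= k < j) `|y k.+1 - y k|)%N.
Proof.
move=> leij; rewrite -(subnKC leij); elim: (j - i)%N => [|d IHd].
  by rewrite addn0 big_geq //; lia.
by rewrite addnS big_nat_recr ?leq_addr //=; lia.
Qed.

(** This is [A + B]. *)
Definition excess {m : nat} (s : 'S_(2 * m + 1)) : nat :=
  (\sum_(0 <= k < 2 * m) `|(edge s k)%:Z - m.+1%:Z|)%N.

Definition near {m : nat} (s : 'S_(2 * m + 1)) : Prop :=
  forall k, (k < 2 * m)%N -> (`|(edge s k)%:Z - m.+1%:Z| <= 1)%N.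

(** What [B = A + 1] amounts to; equality in [edge_le] means that neighbours have weakly opposite
    signs. *)
Definition aligned {m : nat} (s : 'S_(2 * m + 1)) : Prop :=
  (`|centered s 0| + `|centered s (2 * m)|)%N = 1%N /\
  forall k, (k < 2 * m)%N ->
    edge s k = (`|centered s k| + `|centered s k.+1|)%N.

Definition normal {m : nat} (s : 'S_(2 * m + 1)) : Prop :=
  [/\ aligned s, centered s 0 = 0 & 0 < centered s 1].

Lemma aligned_compl {m} (s : 'S_(2 * m + 1)) :
  aligned s -> aligned (s * rev_perm (2 * m + 1))%g.
Proof.
move=> [end1 sum_e]; split=> [|k ltk]; first by rewrite !centered_compl; lia.
by rewrite edge_compl !centered_compl sum_e //; lia.
Qed.

Lemma aligned_rev {m} (s : 'S_(2 * m + 1)) :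
  aligned s -> aligned (rev_perm (2 * m + 1) * s)%g.
Proof.
move=> [end1 sum_e]; split=> [|k ltk].
  by rewrite !centered_rev // subn0 subnn addnC.
rewrite edge_rev // sum_e ?centered_rev // ?(ltnW ltk) //; last lia.
by rewrite addnC; congr (`|centered s _| + _)%N; lia.
Qed.

Lemma excess_compl {m} (s : 'S_(2 * m + 1)) :
  excess (s * rev_perm (2 * m + 1))%g = excess s.
Proof. by apply: eq_bigr => k _; rewrite edge_compl. Qed.

Lemma excess_rev {m} (s : 'S_(2 * m + 1)) :
  excess (rev_perm (2 * m + 1) * s)%g = excess s.
Proof.
rewrite /excess [RHS]big_nat_rev; apply: eq_big_nat => k /andP[_ ltk].
by rewrite edge_rev // add0n.
Qed.

Lemma near_compl {m} (s : 'S_(2 * m + 1)) :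
  near s -> near (s * rev_perm (2 * m + 1))%g.
Proof. by move=> near_s k ltk; rewrite edge_compl near_s. Qed.

Lemma near_rev {m} (s : 'S_(2 * m + 1)) :
  near s -> near (rev_perm (2 * m + 1) * s)%g.
Proof. by move=> near_s k ltk; rewrite edge_rev // near_s //; lia. Qed.

Lemma rev_permK (n : nat) : (rev_perm n * rev_perm n = 1)%g.
Proof. by apply/permP => i; rewrite permM !permE rev_ordK. Qed.

(** One end is 0: reversal moves it to the front, and complementation then makes the next value
    positive. *)
Lemma aligned_normal {m} (s : 'S_(2 * m + 1)) : (0 < m)%N -> aligned s ->
  exists2 t, normal t & s \in [:: t; t * rev_perm (2 * m + 1);
    rev_perm (2 * m + 1) * t; rev_perm (2 * m + 1) * t * rev_perm (2 * m + 1)]%g.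
Proof.
set w := rev_perm _ => m_gt0.
have pos s' : aligned s' -> centered s' 0 = 0 ->
    exists2 t, normal t & s' = t \/ s' = (t * w)%g.
  move=> al0 eq0; case: (ltrP 0 (centered s' 1)) => [gt0|le0].
    by exists s' => //; left.
  exists (s' * w)%g; last by right; rewrite -mulgA rev_permK mulg1.
  split; [exact: aligned_compl | by rewrite centered_compl eq0 |].
  rewrite centered_compl oppr_gt0 lt_neqAle le0 andbT; apply/eqP => eq1.
  by have := centered_inj s' 0 1; lia.
move=> al; case: (eqVneq (centered s 0) 0) => [eq0|neq0].
  have [t nt [->|->]] := pos s al eq0; exists t => //; rewrite !inE eqxx ?orbT //.
have [|t nt] := pos _ (aligned_rev s al).
  by rewrite centered_rev // subn0; have [] := al; lia.
rewrite -/w => eq_ws; exists t => //.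
have {1}-> : (s = w * (w * s))%g by rewrite mulgA rev_permK mul1g.
by case: eq_ws => ->; rewrite ?mulgA !inE eqxx ?orbT.
Qed.

(** * The folded walk of a normal permutation *)

(** Alignment gives weakly opposite signs, and 0 is already taken by position 0. *)
Lemma normal_sign {m} (s : 'S_(2 * m + 1)) (k : nat) : normal s ->
  (0 < k <= 2 * m)%N -> if odd k then 0 < centered s k else centered s k < 0.
Proof.
move=> [[_ sum_e] eq0 gt0]; elim: k => // -[|k] IHk lek //.
have {}IHk := IHk ltac:(lia); have := sum_e k.+1 ltac:(lia).
have := centered_inj s 0 k.+2 ltac:(lia) ltac:(lia).
by rewrite /edge eq0 /=; move: IHk => /=; case: (odd k) => /= ? ? ?; lia.
Qed.

(* Identifies the values [i] and [i - (m + 1)], which are at distance [m + 1]: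
   in a normal permutation the deviation of an edge from [m + 1] becomes the
   length of a step of [fold]. *)
Definition fold {m : nat} (s : 'S_(2 * m + 1)) (k : nat) : int :=
  if odd k then centered s k else centered s k + m.+1%:Z.

(** By the sign pattern an edge is its value at the odd position minus that at the even one; folding
    raises the latter by [m.+1]. *)
Lemma fold_step {m} (s : 'S_(2 * m + 1)) (k : nat) :
  normal s -> (k < 2 * m)%N ->
  `|fold s k.+1 - fold s k|%N = `|(edge s k)%:Z - m.+1%:Z|%N.
Proof.
move=> ns ltk; have [[_ sum_e] eq0 gt0] := ns.
rewrite sum_e // /fold.
case: k ltk => [|k] ltk; first by rewrite /= eq0; lia.
have := normal_sign s k.+1 ns ltac:(lia); have := normal_sign s k.+2 ns ltac:(lia).
by rewrite /=; case: (odd k) => /=; lia.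
Qed.

Lemma fold0 {m} (s : 'S_(2 * m + 1)) : normal s -> fold s 0 = m.+1%:Z.
Proof. by case=> _ eq0 _; rewrite /fold eq0 add0r. Qed.

(** The last value has absolute value 1 and is negative, its position being even. *)
Lemma fold_last {m} (s : 'S_(2 * m + 1)) :
  (0 < m)%N -> normal s -> fold s (2 * m) = m%:Z.
Proof.
move=> m_gt0 ns; have [[end1 _] eq0 _] := ns.
have := normal_sign s (2 * m) ns ltac:(lia).
by rewrite /fold mul2n odd_double -mul2n; move: end1; rewrite eq0; lia.
Qed.

Lemma normal_excess {m} (s : 'S_(2 * m + 1)) :
  (0 < m)%N -> normal s -> (2 * m - 1 <= excess s)%N.
Proof.
move=> m_gt0 ns; have [k lek eq1] := centered_surj s 1 m_gt0.
(* A positive value sits at an odd position, where folding changes nothing. *)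
have y1 : fold s k = 1.
  have := normal_sign s k ns; rewrite /fold; case: k lek eq1 => [|k] lek eq1.
    by have [_] := ns; lia.
  by move/(_ ltac:(lia)); case: odd => //; lia.
(* The walk [fold s] leads from [m + 1] to [m] through [1]. *)
have -> : excess s = (\sum_(0 <= k < 2 * m) `|fold s k.+1 - fold s k|)%N.
  by apply: eq_big_nat => j /andP[_ ltj]; rewrite fold_step.
rewrite (@big_cat_nat _ _ _ k) //=.
have := walk_dist (fold s) 0 k (leq0n k); have := walk_dist (fold s) k (2 * m) lek.
by rewrite y1 fold0 // fold_last //; lia.
Qed.

Lemma near_fold_dist {m} (s : 'S_(2 * m + 1)) (i j : nat) :
  normal s -> near s -> (i <= j <= 2 * m)%N ->
  (`|fold s j - fold s i| <= j - i)%N.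
Proof.
move=> ns near_s /andP[leij lej]; apply: leq_trans (walk_dist _ _ _ leij) _.
rewrite -[X in (_ <= X)%N]muln1 -sum_nat_const_nat big_nat [X in (_ <= X)%N]big_nat.
by apply: leq_sum => k ltk; rewrite fold_step ?near_s //; lia.
Qed.

Lemma near_fold {m} (s : 'S_(2 * m + 1)) (k : nat) :
  (0 < m)%N -> normal s -> near s -> (k <= 2 * m)%N ->
  fold s k = if (k <= m)%N then (m + 1)%:Z - k%:Z else k%:Z - m%:Z.
Proof.
move=> m_gt0 ns near_s lek.
have dist i j := @near_fold_dist m s i j ns near_s.
have y0 := fold0 s ns; have yl := fold_last s m_gt0 ns.
(* Descending from [m + 1] to 1 takes at least [m] steps, and climbing back to [m] at least [m - 1]
   of the [2 * m] available. *)
have bottom j : (j <= 2 * m)%N -> fold s j = 1 -> j = m \/ j = m.+1.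
  move=> lej yj; have := dist 0%N j ltac:(lia).
  by have := dist j (2 * m)%N ltac:(lia); lia.
(* Both elements that fold to [1] sit at positions [m] and [m + 1], which
   leaves the walk no freedom. *)
have [i lei xi] := centered_surj s 1 m_gt0.
have [j lej xj] : exists2 j, (j <= 2 * m)%N & centered s j = - m%:Z.
  by apply: centered_surj; lia.
have [_ eq0 _] := ns.
have i_gt0 : (0 < i)%N by case: (i) xi => //; lia.
have j_gt0 : (0 < j)%N by case: (j) xj => //; lia.
have neq_ij : i <> j by move=> eq_ij; move: xj; rewrite -eq_ij; lia.
have yi : fold s i = 1.
  by have := normal_sign s i ns ltac:(lia); rewrite /fold; case: odd => //; lia.
have yj : fold s j = 1.
  by have := normal_sign s j ns ltac:(lia); rewrite /fold; case: odd => //; lia.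
have ym : fold s m = 1.
  by case: (bottom i lei yi) (bottom j lej yj) => ei [] ej; congruence.
have ym1 : fold s m.+1 = 1.
  by case: (bottom i lei yi) (bottom j lej yj) => ei [] ej; congruence.
(* On either side the distance to cover equals the number of steps, so every step is forced. *)
case: ifP => lekm.
  by have := dist 0%N k ltac:(lia); have := dist k m ltac:(lia); lia.
by have := dist m.+1 k ltac:(lia); have := dist k (2 * m)%N ltac:(lia); lia.
Qed.

(** * The permutation [pi_perm]: uniqueness and product of edges *)

Lemma centered_pi_perm (m k : nat) : (0 < m)%N -> (k <= 2 * m)%N ->
  centered (pi_perm m) k =
    if (k <= m)%N then if odd k then (m + 1)%:Z - k%:Z else - k%:Z
    else if odd k then k%:Z - m%:Z else k%:Z - (2 * m + 1)%:Z.
Proof.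
move=> m_gt0 lek; rewrite /centered permE /pi_fun.
have -> : val (insubd (mid m) k) = k by rewrite insubdK // -topredE /=; lia.
have := iter_rhoE m_gt0 (k := k) ltac:(lia).
by repeat case: ifP => ?; lia.
Qed.

(** At a given position [fold] can be undone, so [near_fold] determines all values. *)
Lemma near_normal_unique {m} (s : 'S_(2 * m + 1)) :
  (0 < m)%N -> normal s -> near s -> s = pi_perm m.
Proof.
move=> m_gt0 ns near_s; apply: centered_ext => k lek.
have := near_fold s k m_gt0 ns near_s lek.
by rewrite centered_pi_perm // /fold; repeat case: ifP => ?; lia.
Qed.

Definition prod_edge {m : nat} (s : 'S_(2 * m + 1)) : nat :=
  (\prod_(0 <= k < 2 * m) edge s k)%N.

Lemma prod_edge_compl {m} (s : 'S_(2 * m + 1)) :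
  prod_edge (s * rev_perm (2 * m + 1))%g = prod_edge s.
Proof. by apply: eq_bigr => k _; rewrite edge_compl. Qed.

Lemma prod_edge_rev {m} (s : 'S_(2 * m + 1)) :
  prod_edge (rev_perm (2 * m + 1) * s)%g = prod_edge s.
Proof.
rewrite /prod_edge [RHS]big_nat_rev; apply: eq_big_nat => k /andP[_ ltk].
by rewrite edge_rev // add0n.
Qed.

Lemma prod_reflect (m : nat) (F : nat -> nat) :
  (\prod_(0 <= k < 2 * m.+1) F k =
   F 0 * F m.+1 * \prod_(0 <= k < m) (F k.+1 * F (2 * m.+1 - k.+1)))%N.
Proof.
rewrite (@big_cat_nat _ _ _ m.+2) //=; last by lia.
have -> : (\prod_(m.+2 <= k < 2 * m.+1) F k
    = \prod_(0 <= k < m) F (2 * m.+1 - k.+1))%N.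
  rewrite -{1}[m.+2]add0n big_addn big_nat_rev.
  have -> : (2 * m.+1 - m.+2 = m)%N by lia.
  by apply: eq_big_nat => k /andP[_ ltk]; congr F; lia.
by rewrite big_nat_recl // big_nat_recr //= big_split /=; lia.
Qed.

Lemma edge_pi_perm (m k : nat) : (0 < m)%N -> (k < 2 * m)%N ->
  edge (pi_perm m) k =
    if k == m then (m + 1)%N else if (k < m)%N (+) odd k then m else (m + 2)%N.
Proof.
move=> m_gt0 ltk; rewrite /edge !centered_pi_perm //; last exact: ltnW.
by rewrite /=; case: (odd k) => /=; repeat case: ifP => ? //=; lia.
Qed.

Lemma prod_edge_pi_perm (m : nat) : (0 < m)%N -> prod_edge (pi_perm m) = max_prod m.
Proof.
case: m => // m m_gt0; rewrite /prod_edge prod_reflect !edge_pi_perm //; try lia.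
(* Reflected indices have equal parity but lie on opposite sides of the middle, so one edge of each
   pair is [m.+1] and the other [m.+1 + 2]. *)
rewrite eqxx /= (eq_big_nat _ _ (F2 := fun=> m.+1 * (m.+1 + 2))%N) => [|k /andP[_ ltk]].
  by rewrite prod_nat_const_nat subn0 /max_prod subn1 /= expnMn expnS; lia.
rewrite !edge_pi_perm //; try lia.
by case: (boolP (odd k.+1)) => ok; repeat case: ifP => ?; lia.
Qed.

(** * The upper bound and the case of equality *)

Lemma prod_edge_le_majorant {m} (s : 'S_(2 * m + 1)) :
  (prod_edge s)%:R <= \prod_(0 <= k < 2 * m) majorant m.+1 (edge s k).
Proof.
by rewrite natr_prod; apply: ler_prod => k _; rewrite ler0n le_majorant.
Qed.

Lemma prod_edge_lt_majorant {m} (s : 'S_(2 * m + 1)) (k : nat) :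
  (k < 2 * m)%N -> (1 < `|(edge s k)%:Z - m.+1%:Z|)%N ->
  (prod_edge s)%:R < \prod_(0 <= k < 2 * m) majorant m.+1 (edge s k).
Proof.
move=> ltk far; rewrite natr_prod !big_mkord.
rewrite (bigD1 (Ordinal ltk)) //= [ltRHS](bigD1 (Ordinal ltk)) //=.
set A := \prod_(i < _ | _) _; set B := \prod_(i < _ | _) _.
have A_gt0 : 0 < A by apply: prodr_gt0 => i _; rewrite ltr0n edge_gt0.
have le_AB : A <= B by apply: ler_prod => i _; rewrite ler0n le_majorant.
apply: lt_le_trans (_ : majorant m.+1 (edge s k) * A <= _).
  by rewrite ltr_pM2r // lt_majorant.
by apply: ler_wpM2l => //; apply: le_trans (le_majorant _ _ (ltn0Sn m)).
Qed.

(** Bounding the majorants rather than the edges lets the equality case exclude any edge with a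
    strict majorant. *)
Lemma prod_majorant_le {m} (s : 'S_(2 * m + 1)) : (0 < m)%N ->
  let Q := \prod_(0 <= k < 2 * m) majorant m.+1 (edge s k) in
  Q < (max_prod m)%:R \/ aligned s /\ Q <= (max_prod m)%:R.
Proof.
move=> m_gt0 /=; rewrite prod_majorant.
set a := (\sum_(0 <= k < _) (_ - m.+1))%N; set b := (\sum_(0 <= k < _) (_ - edge s _))%N.
(* Termwise, [(c - e) + e = (e - c) + c] for truncated subtraction. *)
have sum_ab : (b + \sum_(0 <= k < 2 * m) edge s k = a + 2 * m * m.+1)%N.
  rewrite -[X in (_ + X * _)%N]subn0 -sum_nat_const_nat -!big_split /=.
  by apply: eq_bigr => k _; lia.
have ends_gt0 := ends_neq0 s m_gt0; have sum_ends := sum_edge_ends s.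
have le_edge : (\sum_(0 <= k < 2 * m) edge s k
    <= \sum_(0 <= k < 2 * m) (`|centered s k| + `|centered s k.+1|))%N.
  by apply: leq_sum => k _; apply: edge_le.
have [leab|ltba] := leqP (a + 2)%N b; [left|right].
  exact: unaligned_estimate.
(* With [b < a + 2] the ends contribute exactly 1 and [le_edge] is an equality, hence an equality in
   each term. *)
have al : aligned s.
  split=> [|k ltk]; first by lia.
  have : (\sum_(0 <= k < 2 * m) edge s k
    = \sum_(0 <= k < 2 * m) (`|centered s k| + `|centered s k.+1|))%N by lia.
  rewrite !big_mkord => /eqP.
  rewrite (leqif_sum (fun i _ => conj (edge_le s (val i)) erefl)).
  by move=> /forallP /(_ (Ordinal ltk)) /eqP.
split=> //; apply: aligned_estimate => //; first by lia.
have -> : (a + b = excess s)%N.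
  by rewrite -big_split /=; apply: eq_bigr => k _; lia.
have [t nt] := aligned_normal s m_gt0 al; have := normal_excess t m_gt0 nt.
by rewrite !inE => lt /or4P[]/eqP->; rewrite ?excess_compl ?excess_rev ?excess_compl.
Qed.

Lemma prod_edge_le {m} (s : 'S_(2 * m + 1)) :
  (0 < m)%N -> (prod_edge s <= max_prod m)%N.
Proof.
move=> m_gt0; rewrite -(ler_nat rat); apply: le_trans (prod_edge_le_majorant s) _.
by case: (prod_majorant_le s m_gt0) => [/ltW|[]].
Qed.

Lemma prod_edge_eq {m} (s : 'S_(2 * m + 1)) : (0 < m)%N ->
  prod_edge s = max_prod m <->
  s \in [:: pi_perm m; pi_perm m * rev_perm (2 * m + 1);
    rev_perm (2 * m + 1) * pi_perm m;
    rev_perm (2 * m + 1) * pi_perm m * rev_perm (2 * m + 1)]%g.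
Proof.
move=> m_gt0; split=> [eq_max|]; last first.
  rewrite !inE => /or4P[]/eqP->;
  by rewrite ?prod_edge_compl ?prod_edge_rev prod_edge_pi_perm.
have [lt_max|[al le_max]] := prod_majorant_le s m_gt0.
  by have := le_lt_trans (prod_edge_le_majorant s) lt_max; rewrite eq_max ltxx.
have near_s : near s.
  move=> k ltk; rewrite leqNgt; apply/negP => far.
  by have := lt_le_trans (prod_edge_lt_majorant s k ltk far) le_max; rewrite eq_max ltxx.
have [t nt st] := aligned_normal s m_gt0 al.
suff near_t : near t by rewrite -(near_normal_unique t m_gt0 nt near_t).
have near_comp (u : 'S_(2 * m + 1)) : near (u * rev_perm (2 * m + 1))%g -> near u.
  by move/near_compl; rewrite -mulgA rev_permK mulg1.
have near_revp (u : 'S_(2 * m + 1)) : near (rev_perm (2 * m + 1) * u)%g -> near u.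
  by move/near_rev; rewrite mulgA rev_permK mul1g.
by move: st near_s; rewrite !inE => /or4P[]/eqP-> //;
  [move/near_comp | move/near_revp | move/near_comp/near_revp].
Qed.

(** The centred end values are (0, -1), (0, 1), (-1, 0) and (1, 0). *)
Lemma uniq_pi_perms (m : nat) : (0 < m)%N ->
  uniq [:: pi_perm m; pi_perm m * rev_perm (2 * m + 1);
    rev_perm (2 * m + 1) * pi_perm m;
    rev_perm (2 * m + 1) * pi_perm m * rev_perm (2 * m + 1)]%g.
Proof.
move=> m_gt0; apply: (@map_uniq _ _ (fun s => (centered s 0, centered s (2 * m)))).
rewrite /= !centered_compl !centered_rev // subn0 subnn !centered_pi_perm //.
rewrite !inE /= !xpair_eqE mul2n odd_double -mul2n.
by repeat case: ifP => ?; lia.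
Qed.

(** * From products of edges to the stretch *)

Lemma mstretchE (R : realType) {m} (s : 'S_(2 * m + 1)) :
  mstretch R s = (prod_edge s)%:R `^ (2 * m)%:R^-1.
Proof.
rewrite /mstretch (_ : (2 * m + 1).-1 = (2 * m)%N); last by lia.
congr (_ `^ _).
rewrite /prod_edge natr_prod.
(* The last index has no successor, so its inner product is empty and equals 1. *)
pose G k : R := if (k < 2 * m)%N then (edge s k)%:R else 1.
transitivity (\prod_(i < 2 * m + 1) G i).
  apply: eq_bigr => i _; rewrite /G; case: ifP => lti; last first.
    by rewrite big_pred0 // => j; apply/eqP => /= eq_j; have := ltn_ord j; lia.
  have lti1 : (i.+1 < 2 * m + 1)%N by lia.
  rewrite (big_pred1 (Ordinal lti1)) => [|j]; last by rewrite /= -val_eqE.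
  rewrite /edge -[X in centered s X.+1]/(val i) centered_ord.
  rewrite -[i.+1]/(val (Ordinal lti1)) centered_ord natr_absz intr_norm.
  by rewrite opprB addrA subrK rmorphB /= !pmulrn.
rewrite -(big_mkord xpredT G) addn1 big_nat_recr //= {2}/G ltnn mulr1.
by apply: eq_big_nat => k /andP[_ ltk]; rewrite /G ltk.
Qed.

Theorem theorem4p14 (R : realType) (m : nat) (hm : (1 < 2 * m + 1)%N) :
  let n := (2 * m + 1)%N in
  let M : R := (m ^ m * (m + 1) * (m + 2) ^ (m - 1))%N%:R `^ (n - 1)%:R^-1 in
  let p : 'S_n := pi_perm m in
  (* composition: (s * t) i = t (s i) *)
  let p_compl : 'S_n := (p * rev_perm n)%g in
  let p_rev : 'S_n := (rev_perm n * p)%g in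
  let p_rev_compl : 'S_n := (rev_perm n * p * rev_perm n)%g in
  [/\ forall s : 'S_n, mstretch R s <= M,
      forall s : 'S_n, mstretch R s = M <->
        s \in [:: p; p_compl; p_rev; p_rev_compl]
    & uniq [:: p; p_compl; p_rev; p_rev_compl]].
Proof.
have m_gt0 : (0 < m)%N by lia.
move=> n M p p_compl p_rev p_rev_compl; rewrite /M addnK -/(max_prod m).
have exp_gt0 : 0 < (2 * m)%:R^-1 :> R by rewrite invr_gt0 ltr0n muln_gt0.
split=> [s|s|]; last exact: uniq_pi_perms.
  rewrite mstretchE ge0_ler_powR ?nnegrE ?ler0n ?(ltW exp_gt0) //.
  by rewrite ler_nat prod_edge_le.
rewrite mstretchE -(prod_edge_eq s m_gt0); split=> [|->//].
move/(powR_injective exp_gt0); rewrite !nnegrE !ler0n => /(_ isT isT) /eqP.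
by rewrite eqr_nat => /eqP.
Qed.
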